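(* Let $G$ be a group and let $S \subseteq G$ be a locally maximal product-free set with $|S| = 3$, such that every two-element subset of $S$ generates $\langle S\rangle$. Then $|G| \leq 24$.
   Context: A non-empty subset $S$ of a group $G$ is product-free if $ab \notin S$ for all $a, b \in S$. It is locally maximal product-free if it is product-free and is not properly contained in any other product-free subset of $G$. $\langle S \rangle$ denotes the subgroup generated by $S$. *)

(* Defs.v *)
From Stdlib Require Import List Arith.
Import ListNotations.

Record Group := {
  carrier :> Type;
  gmul : carrier -> carrier -> carrier;
  gone : carrier;
  ginv : carrier -> carrier;
  gmulA : forall x y z, gmul x (gmul y z) = gmul (gmul x y) z;
  gmul1 : forall x, gmul gone x = x;
  gmulV : forall x, gmul (ginv x) x = gone
}.

Definition subset {G : Group} (A B : G -> Prop) : Prop := forall x, A x -> B x.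

Definition product_free {G : Group} (S : G -> Prop) : Prop :=
  (exists x, S x) /\ forall a b, S a -> S b -> ~ S (gmul G a b).

Definition locally_maximal_product_free {G : Group} (S : G -> Prop) : Prop :=
  product_free S /\
  forall T : G -> Prop, product_free T -> subset S T -> subset T S.

Definition is_subgroup {G : Group} (H : G -> Prop) : Prop :=
  H (gone G) /\ (forall x y, H x -> H y -> H (gmul G x y)) /\
  (forall x, H x -> H (ginv G x)).

Definition generated {G : Group} (A : G -> Prop) : G -> Prop :=
  fun x => forall H, is_subgroup H -> subset A H -> H x.

Definition card3 {G : Group} (S : G -> Prop) : Prop :=
  exists a b c : G, a <> b /\ a <> c /\ b <> c /\
    forall x, S x <-> (x = a \/ x = b \/ x = c).

Definition order_le (G : Group) (n : nat) : Prop :=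
  exists l : list G, NoDup l /\ (forall x, In x l) /\ length l <= n.

(* Main.v *)
(* Local maximality means that every x in G lies in T(S), the set of all s, st,
   st^-1 and s^-1t with s, t in S, or satisfies x^2 in S. Each word in the
   elements a, b, c of S is therefore equal to one of at most 25 short words, or
   its square is one of a, b, c. Branching on these relations for a few words,
   and completing partial Cayley tables as in the Todd-Coxeter procedure, every
   branch either violates product-freeness or shows that two elements of S,
   hence S, generate a group of order at most 24. The condition for x = s^-1, with
   s in S, shows that up to a permutation of S one may start from one of six
   sets of relators.

   Let H be the subgroup generated by S and suppose that G is not H. Elements x
   outside H have x^2 in S, as T(S) is contained in H; with s = x^2, the
   squares of the elements x s^k show that the odd powers of s are in S. Hence s has order 2
   or 6. If order 6 occurs, then S = {s, s^3, s^5}, H has order 6, and its index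
   is at most 4. Otherwise all squares of elements outside H are one involution
   of S, so that H has order at most 12 and index 2. The bounds on the order and
   the index again come from Cayley tables, with up to three additional
   generators outside H. *)

Require Import Defs.
From Stdlib Require Import List Arith Lia PArith FMapPositive Classical.
Import ListNotations.

(** * Words and partial Cayley tables *)

Module PM := PositiveMap.

Inductive letter := La | La' | Lb | Lb' | Lc | Lc' | Ld | Ld' | Le | Le' | Lf | Lf'.

Definition linv (l : letter) : letter :=
  match l with
  | La => La' | La' => La | Lb => Lb' | Lb' => Lb | Lc => Lc' | Lc' => Lc
  | Ld => Ld' | Ld' => Ld | Le => Le' | Le' => Le | Lf => Lf' | Lf' => Lf
  end.

Definition word := list letter.
Definition winv (w : word) : word := rev (map linv w).

(* The vertices of a Cayley table are words, packed in a positive with four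
   bits per letter. As [val] below evaluates a vertex in the group, all entries
   of a table remain true statements when vertices are identified. *)
Definition child (x : positive) (l : letter) : positive :=
  match l with
  | La => x~0~0~0~0 | La' => x~0~0~0~1 | Lb => x~0~0~1~0 | Lb' => x~0~0~1~1
  | Lc => x~0~1~0~0 | Lc' => x~0~1~0~1 | Ld => x~0~1~1~0 | Ld' => x~0~1~1~1
  | Le => x~1~0~0~0 | Le' => x~1~0~0~1 | Lf => x~1~0~1~0 | Lf' => x~1~0~1~1
  end.

Definition letter_code (l : letter) : positive := child 1 l.
Definition letter_eqb (l m : letter) : bool := Pos.eqb (letter_code l) (letter_code m).

(* [cells] maps a vertex to a vertex that denotes the same element; [rules]
   holds the relators, with their rotations and inverses, by first letter;
   [recent] holds the edges at which the relators have not been traced yet. *)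
Record table := Table {
  cells : PM.t positive;
  nodes : list positive;
  live : nat;
  recent : list (positive * letter);
  rules : PM.t (list word) }.

(** Union-find without path compression; a representative is its own cell. Too little fuel still
    yields a vertex of equal value. *)
Fixpoint find_from (fuel : nat) (m : PM.t positive) (x : positive) : positive :=
  match fuel with
  | 0 => x
  | S k => match PM.find x m with
           | None => x
           | Some y => if Pos.eqb x y then x else find_from k m y
           end
  end.

Definition find (t : table) (x : positive) : positive := find_from 60 (cells t) x.

(** An edge is the cell of the word [child x l], so that edges and identifications of vertices share
    one map. *)
Definition get (t : table) (x : positive) (l : letter) : option positive :=
  option_map (find t) (PM.find (child x l) (cells t)).

Definition equations := list (positive * positive).

Definition add_half_edge (x : positive) (l : letter) (y : positive)
    (tq : table * equations) : table * equations :=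
  let (t, q) := tq in
  match get t x l with
  | Some u => (t, if Pos.eqb u y then q else (u, y) :: q)
  | None => (Table (PM.add (child x l) y (cells t)) (nodes t) (live t)
               ((x, l) :: recent t) (rules t), q)
  end.

Definition add_edge (x : positive) (l : letter) (y : positive)
    (tq : table * equations) : table * equations :=
  add_half_edge y (linv l) x (add_half_edge x l y tq).

Definition move_row (b a : positive) (ls : list letter)
    (tq : table * equations) : table * equations :=
  fold_left (fun tq l => match get (fst tq) b l with
                         | None => tq
                         | Some z => add_edge a l z tq
                         end) ls tq.

(** The smaller vertex survives a coincidence, so that the vertex 1 of the identity is never
    absorbed. *)
Fixpoint merge_all (ls : list letter) (fuel : nat) (tq : table * equations) : table :=
  match fuel, tq with
  | S k, (t, (x, y) :: q) =>
      let x := find t x in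
      let y := find t y in
      if Pos.eqb x y then merge_all ls k (t, q) else
      let a := Pos.min x y in
      let b := Pos.max x y in
      merge_all ls k (move_row b a ls
        (Table (PM.add b a (cells t)) (nodes t) (pred (live t)) (recent t) (rules t), q))
  | _, (t, _) => t
  end.

(* Running out of fuel only makes a table less complete. *)
Definition fuel : nat := 1000.

Fixpoint walk (t : table) (x : positive) (w : word) : positive * word :=
  match w with
  | [] => (x, [])
  | l :: w' => match get t x l with None => (x, w) | Some y => walk t y w' end
  end.

(* Traces the relator [w] from [x] and from [x] backwards: a gap of a single
   edge is filled, and a closed trace that misses [x] gives an equation. *)
Definition scan (ls : list letter) (x : positive) (t : table) (w : word) : table :=
  match walk t x w with
  | (y, []) => if Pos.eqb y x then t else merge_all ls fuel (t, [(y, x)])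
  | (y, l :: r) =>
      match walk t x (winv r) with
      | (z, []) => merge_all ls fuel (add_edge y l z (t, []))
      | _ => t
      end
  end.

Definition rules_at (m : PM.t (list word)) (l : letter) : list word :=
  match PM.find (letter_code l) m with Some ws => ws | None => [] end.

(** As the rules contain all rotations and inverses, tracing those that begin with [l] from [x]
    covers every passage of a relator through the new edge. *)
Fixpoint close (ls : list letter) (k : nat) (t : table) : table :=
  match k, recent t with
  | S k', (x, l) :: r =>
      let t1 := Table (cells t) (nodes t) (live t) r (rules t) in
      close ls k'
        (if Pos.eqb (find t1 x) x
         then fold_left (fun t w => scan ls (find t x) t w) (rules_at (rules t1) l) t1 else t1)
  | _, _ => t
  end.

Definition define (t : table) (x : positive) (l : letter) : table * positive :=
  match get t x l with
  | Some y => (t, y)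
  | None =>
      let y := child x l in
      (Table (PM.add (child y (linv l)) x (PM.add y y (cells t))) (y :: nodes t) (S (live t))
         ((x, l) :: (y, linv l) :: recent t) (rules t), y)
  end.

Fixpoint define_path (t : table) (x : positive) (w : word) : table * positive :=
  match w with
  | [] => (t, x)
  | l :: w' => let (t1, y) := define t x l in define_path t1 y w'
  end.

(** One pass in order of creation, as [nodes] has the newest vertex first; [size] keeps large or
    infinite enumerations in check. *)
Definition extend (ls : list letter) (size : nat) (t : table) : table :=
  fold_left (fun t x =>
    fold_left (fun t l =>
      if Nat.leb size (live t) then t else
      if Pos.eqb (find t x) x
      then match get t x l with
           | Some _ => t
           | None => close ls fuel (fst (define t x l))
           end
      else t) ls t)
    (rev (nodes t)) t.

Fixpoint free_reduce (w : word) : word :=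
  match w with
  | [] => []
  | l :: w' =>
      match free_reduce w' with
      | [] => [l]
      | m :: r => if letter_eqb m (linv l) then r else l :: m :: r
      end
  end.

Fixpoint rotations (k : nat) (w : word) : list word :=
  match k, w with
  | S k', l :: w' => w :: winv w :: rotations k' (w' ++ [l])
  | _, _ => []
  end.

Definition add_rule (m : PM.t (list word)) (w : word) : PM.t (list word) :=
  match w with
  | [] => m
  | l :: _ => PM.add (letter_code l) (w :: rules_at m l) m
  end.

Definition add_relator (ls : list letter) (t : table) (r : word) : table :=
  let w := free_reduce r in
  let t1 := Table (cells t) (nodes t) (live t) (recent t)
              (fold_left add_rule (rotations (length w) w) (rules t)) in
  let (t2, y) := define_path t1 1 w in
  let t3 := merge_all ls fuel (t2, [(y, xH)]) in
  close ls fuel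
    (fold_left (fun t x => if Pos.eqb (find t x) x then scan ls x t w else t) (nodes t3) t3).

(** * Branching on the conditions imposed by local maximality *)

Definition S_letters := [La; Lb; Lc].

(* The set T(S) of all s, st, st^-1 and s^-1t with s, t in S, where the
   identity is represented by the empty word. *)
Definition T_words : list word :=
  [] :: map (fun s => [s]) S_letters ++
  flat_map (fun s => map (fun r => [s; r]) S_letters) S_letters ++
  flat_map (fun s => map (fun r => [s; linv r]) S_letters) S_letters ++
  flat_map (fun s => map (fun r => [linv s; r]) S_letters) S_letters.

(** The pairs that |S| = 3 and product-freeness keep apart in G. *)
Definition distinct_words : list (word * word) :=
  [([La], [Lb]); ([La], [Lc]); ([Lb], [Lc])] ++
  flat_map (fun s => flat_map (fun r => map (fun u => ([s; r], [u])) S_letters) S_letters) S_letters.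

Definition locate (t : table) (w : word) : option positive :=
  match walk t 1 w with (x, []) => Some x | _ => None end.

Definition contradictory (t : table) : bool :=
  existsb (fun p => match locate t (fst p), locate t (snd p) with
                    | Some x, Some y => Pos.eqb x y | _, _ => false end) distinct_words.

Definition mem (x : positive) (l : list positive) : bool := existsb (Pos.eqb x) l.

Fixpoint orbit (t : table) (ls : list letter) (fuel : nat) (seen todo : list positive) : list positive :=
  match fuel, todo with
  | S k, x :: todo' =>
      if mem x seen then orbit t ls k seen todo'
      else orbit t ls k (x :: seen)
             (fold_right (fun l acc => match get t x l with Some y => y :: acc | None => acc end) todo' ls)
  | _, _ => seen
  end.

Definition closed_under (t : table) (ls : list letter) (L : list positive) : bool :=
  forallb (fun x => forallb (fun l => match get t x l with Some y => mem y L | None => false end) ls) L.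

(** Closure of the orbit is tested afterwards, so that nothing has to be proved about [orbit]; its
    fuel suffices for [n] vertices with four neighbours each. *)
Definition small_pair (t : table) (n : nat) (g h : letter) : bool :=
  let ls := [g; linv g; h; linv h] in
  let L := orbit t ls (6 * n) [] [xH] in
  (Nat.leb (length L) n && mem xH L && closed_under t ls L)%bool.

Definition finished (n : nat) (t : table) : bool :=
  (contradictory t || small_pair t n La Lb || small_pair t n La Lc || small_pair t n Lb Lc)%bool.

(** Words of T(S) that the table already identifies lead to equivalent branches; one of them is
    enough. *)
Fixpoint dedup (t : table) (seen : list positive) (ws : list word) : list word :=
  match ws with
  | [] => []
  | w :: ws' => match locate t w with
                | Some x => if mem x seen then dedup t seen ws' else w :: dedup t (x :: seen) ws'
                | None => w :: dedup t seen ws'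
                end
  end.

Definition is_S_letter (l : letter) : bool :=
  match l with La | La' | Lb | Lb' | Lc | Lc' => true | _ => false end.

Fixpoint extends_by_S (p w : word) : bool :=
  match p, w with
  | [], _ => forallb is_S_letter w
  | l :: p', m :: w' => (letter_eqb l m && extends_by_S p' w')%bool
  | _, [] => false
  end.

(* [outer] lists words that denote elements outside the subgroup generated by
   S: a word that extends one of them by letters of S is outside T(S), so that
   its square is in S. *)
Definition options (outer : list word) (t : table) (w : word) : list word :=
  map (fun s => w ++ w ++ [linv s]) S_letters ++
  if existsb (fun p => extends_by_S p w) outer then []
  else map (fun u => w ++ winv u) (dedup t [] T_words).

Definition refine (ls : list letter) (size : nat) (t : table) (r : word) : table :=
  let t1 := add_relator ls t r in
  if contradictory t1 then t1 else extend ls size t1.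

(** The paths of T(S) come first, so that [contradictory] and [dedup] can locate these words. *)
Definition start (ls : list letter) (size : nat) (rs : list word) : table :=
  let t0 := fold_left (fun t w => fst (define_path t 1 w)) T_words
     (Table (PM.add 1%positive 1%positive (PM.empty _)) [1%positive] 1 [] (PM.empty _)) in
  extend ls size (fold_left (add_relator ls) rs t0).

(* In [Br w ts] one branches on the word [w]; the trees [ts] belong, in order, to
   those options for [w] that do not finish by themselves. *)
Inductive tree := Br : word -> list tree -> tree.

Definition branches (ls : list letter) (size n : nat) (outer : list word) (t : table) (w : word) :
    list table :=
  filter (fun t => negb (finished n t)) (map (refine ls size t) (options outer t w)).

Fixpoint check (ls : list letter) (size n : nat) (outer : list word) (tr : tree) (t : table) : bool :=
  match tr with
  | Br w trs =>
      (fix go (trs : list tree) (ts : list table) : bool :=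
        match trs, ts with
        | _, [] => true
        | [], _ => false
        | tr :: trs', t :: ts' => (check ls size n outer tr t && go trs' ts')%bool
        end) trs (branches ls size n outer t w)
  end.

Definition certified (ls : list letter) (size n : nat) (outer rs : list word) (tr : tree) : bool :=
  let t := start ls size rs in (finished n t || check ls size n outer tr t)%bool.

Lemma find_add (A : Type) (m : PM.t A) k v p :
  PM.find p (PM.add k v m) = if Pos.eqb p k then Some v else PM.find p m.
Proof.
destruct (Pos.eqb_spec p k) as [->|N]; [apply PM.gss | now apply PM.gso].
Qed.

(** * Elementary group identities *)

Section GroupFacts.

Variable G : Group.
Implicit Types x y z : G.

Local Notation "x * y" := (gmul G x y).
Local Notation "1" := (gone G).
Local Notation "x ^-1" := (ginv G x) (at level 3, left associativity, format "x ^-1").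

Lemma gmulKV x y : x^-1 * (x * y) = y.
Proof. now rewrite gmulA, gmulV, gmul1. Qed.

Lemma gmulI x y z : x * y = x * z -> y = z.
Proof. intro E; rewrite <- (gmulKV x y), E; apply gmulKV. Qed.

Lemma gmulr1 x : x * 1 = x.
Proof.
apply (gmulI x^-1); now rewrite gmulKV, <- (gmul1 G (x^-1 * x)), gmulV, gmul1.
Qed.

Lemma gmulrV x : x * x^-1 = 1.
Proof. apply (gmulI x^-1); now rewrite gmulKV, gmulr1. Qed.

Lemma gmulrK x y : x * (x^-1 * y) = y.
Proof. now rewrite gmulA, gmulrV, gmul1. Qed.

Lemma ginv_unique x y : x * y = 1 -> y = x^-1.
Proof. intro E; apply (gmulI x); now rewrite gmulrV. Qed.

Lemma ginvK x : x^-1^-1 = x.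
Proof. symmetry; apply ginv_unique, gmulV. Qed.

Lemma ginvM x y : (x * y)^-1 = y^-1 * x^-1.
Proof. symmetry; apply ginv_unique; now rewrite <- gmulA, gmulrK, gmulrV. Qed.

Lemma ginv1 : 1^-1 = 1.
Proof. symmetry; apply ginv_unique, gmul1. Qed.

End GroupFacts.

Ltac group := repeat rewrite ?ginvM, ?ginvK, ?ginv1, <- ?gmulA, ?gmulKV, ?gmulrK,
  ?gmulr1, ?gmul1, ?gmulV, ?gmulrV.

(** * Soundness of the tables in a group *)

Section Tables.

Variables (G : Group) (env : letter -> G).
Hypothesis env_linv : forall l, env (linv l) = ginv G (env l).

Local Notation "x * y" := (gmul G x y).
Local Notation "1" := (gone G).

Fixpoint ev (w : word) : G :=
  match w with [] => 1 | l :: w' => env l * ev w' end.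

Fixpoint val (x : positive) : G :=
  match x with
  | (x~0~0~0~0)%positive => val x * env La | (x~0~0~0~1)%positive => val x * env La'
  | (x~0~0~1~0)%positive => val x * env Lb | (x~0~0~1~1)%positive => val x * env Lb'
  | (x~0~1~0~0)%positive => val x * env Lc | (x~0~1~0~1)%positive => val x * env Lc'
  | (x~0~1~1~0)%positive => val x * env Ld | (x~0~1~1~1)%positive => val x * env Ld'
  | (x~1~0~0~0)%positive => val x * env Le | (x~1~0~0~1)%positive => val x * env Le'
  | (x~1~0~1~0)%positive => val x * env Lf | (x~1~0~1~1)%positive => val x * env Lf'
  (* Meant for the vertex 1, the empty word. *)
  | _ => 1
  end.

Lemma val_child x l : val (child x l) = val x * env l.
Proof. now destruct l. Qed.

Lemma letter_eqb_eq l m : letter_eqb l m = true -> l = m.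
Proof. destruct l, m; discriminate || reflexivity. Qed.

Lemma ev_app v w : ev (v ++ w) = ev v * ev w.
Proof. induction v as [|l v IH]; simpl; [now rewrite gmul1 | now rewrite IH, gmulA]. Qed.

Lemma ev_winv w : ev (winv w) = ginv G (ev w).
Proof.
unfold winv; induction w as [|l w IH]; simpl; [now rewrite ginv1|].
now rewrite ev_app, IH, ginvM; simpl; rewrite gmulr1, env_linv.
Qed.

Lemma ev_free_reduce w : ev (free_reduce w) = ev w.
Proof.
induction w as [|l w IH]; simpl; [reflexivity|].
rewrite <- IH; destruct (free_reduce w) as [|m r]; [reflexivity|].
destruct (letter_eqb m (linv l)) eqn:E; [|reflexivity].
apply letter_eqb_eq in E; subst m; simpl; now rewrite env_linv, gmulrK.
Qed.

Definition sound_rules (m : PM.t (list word)) : Prop :=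
  forall k ws w, PM.find k m = Some ws -> In w ws -> ev w = 1.

(** The only invariant is that every entry is true in G. Completeness, where it matters, is tested
    by [closed_under]. *)
Definition sound (t : table) : Prop :=
  (forall p q, PM.find p (cells t) = Some q -> val p = val q) /\ sound_rules (rules t).

Definition sound_eqs (tq : table * equations) : Prop :=
  sound (fst tq) /\ forall x y, In (x, y) (snd tq) -> val x = val y.

Lemma sound_add t k v ns n r :
  sound t -> val k = val v -> sound (Table (PM.add k v (cells t)) ns n r (rules t)).
Proof.
intros [Hc Hr] E; split; [|exact Hr]; simpl; intros p q.
rewrite find_add; destruct (Pos.eqb_spec p k) as [->|_]; [|apply Hc].
now intros [= <-].
Qed.

Lemma val_find t x : sound t -> val (find t x) = val x.
Proof.
intros [Hc _]; unfold find; generalize 60; intro n; revert x.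
induction n as [|n IH]; intro x; simpl; [reflexivity|].
destruct (PM.find x (cells t)) as [y|] eqn:E; [|reflexivity].
destruct (Pos.eqb x y); [reflexivity|]; rewrite IH; symmetry; now apply Hc.
Qed.

Lemma val_get t x l y : sound t -> get t x l = Some y -> val y = val x * env l.
Proof.
intros Ht; unfold get; destruct (PM.find (child x l) (cells t)) as [z|] eqn:E; [|discriminate].
intros [= <-]; rewrite val_find, <- val_child by assumption; symmetry; now apply Ht.
Qed.

Lemma sound_half_edge x l y tq :
  sound_eqs tq -> val y = val x * env l -> sound_eqs (add_half_edge x l y tq).
Proof.
destruct tq as [t q]; intros [Ht Hq] E; simpl in Ht, Hq; unfold add_half_edge.
destruct (get t x l) as [u|] eqn:Eu.
- split; [exact Ht|]; simpl; destruct (Pos.eqb u y); [exact Hq|].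
  intros x' y' [[= <- <-]|H]; [|now apply Hq].
  rewrite E; now apply val_get with t.
- split; [|exact Hq]; apply sound_add; [exact Ht|]; now rewrite val_child.
Qed.

Lemma sound_edge x l y tq :
  sound_eqs tq -> val y = val x * env l -> sound_eqs (add_edge x l y tq).
Proof.
intros H E; apply sound_half_edge; [now apply sound_half_edge|].
now rewrite env_linv, E, <- gmulA, gmulrV, gmulr1.
Qed.

Lemma sound_move_row b a ls tq :
  sound_eqs tq -> val a = val b -> sound_eqs (move_row b a ls tq).
Proof.
unfold move_row; revert tq; induction ls as [|l ls IH]; intros tq H E; simpl; [exact H|].
apply IH; [|exact E]; destruct (get (fst tq) b l) as [z|] eqn:Ez; [|exact H].
apply sound_edge; [exact H|]; rewrite E; apply val_get with (fst tq); [apply H | exact Ez].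
Qed.

Lemma sound_merge_all ls k tq : sound_eqs tq -> sound (merge_all ls k tq).
Proof.
revert tq; induction k as [|k IH]; intros [t [|[x y] q]] H; try apply H; simpl.
destruct H as [Ht Hq]; simpl in Ht, Hq.
assert (E : val (find t x) = val (find t y))
  by (rewrite !val_find by exact Ht; apply Hq; now left).
destruct (Pos.eqb (find t x) (find t y)).
- apply IH; split; [exact Ht|]; intros x' y' H; apply Hq; now right.
- assert (E' : val (Pos.max (find t x) (find t y)) = val (Pos.min (find t x) (find t y))).
  { destruct (Pos.max_spec (find t x) (find t y)) as [[_ ->]|[_ ->]];
    destruct (Pos.min_spec (find t x) (find t y)) as [[_ ->]|[_ ->]]; congruence. }
  apply IH, sound_move_row; [split|congruence].
  + now apply sound_add.
  + intros x' y' H; apply Hq; now right.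
Qed.

Local Arguments merge_all : simpl never.

Lemma val_walk t x w :
  sound t -> val (fst (walk t x w)) * ev (snd (walk t x w)) = val x * ev w.
Proof.
intro Ht; revert x; induction w as [|l w IH]; intro x; simpl; [reflexivity|].
destruct (get t x l) as [y|] eqn:E; [|reflexivity].
rewrite IH, gmulA; f_equal; now apply val_get with t.
Qed.

(** If the forward trace stops at y before the letter l and the backward trace of the rest r ends at
    z, then y l r = x = z r, hence y l = z. *)
Lemma sound_scan ls x t w : sound t -> ev w = 1 -> sound (scan ls x t w).
Proof.
intros Ht Ew; unfold scan.
generalize (val_walk t x w Ht); destruct (walk t x w) as [y [|l r]]; simpl.
- rewrite Ew, !gmulr1; intro E; destruct (Pos.eqb y x); [exact Ht|].
  apply sound_merge_all; split; [exact Ht|]; now intros x' y' [[= <- <-]|[]].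
- rewrite Ew, gmulr1; intro E.
  generalize (val_walk t x (winv r) Ht); destruct (walk t x (winv r)) as [z [|m s]]; simpl; [|auto].
  rewrite gmulr1, ev_winv; intro E'.
  apply sound_merge_all, sound_edge; [split; [exact Ht|]; now intros|].
  rewrite E', <- E; now group.
Qed.

Lemma sound_rules_at m l w : sound_rules m -> In w (rules_at m l) -> ev w = 1.
Proof.
intros H; unfold rules_at.
destruct (PM.find (letter_code l) m) as [ws|] eqn:E; [|easy]; now apply H with (letter_code l).
Qed.

Lemma sound_fold {A : Type} (f : table -> A -> table) (As : list A) t :
  (forall t x, In x As -> sound t -> sound (f t x)) -> sound t -> sound (fold_left f As t).
Proof.
revert t; induction As as [|x As IH]; intros t H Ht; simpl; [exact Ht|].
apply IH; [|apply H; [now left | exact Ht]]; intros t' x' H'; apply H; now right.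
Qed.

Lemma sound_close ls k t : sound t -> sound (close ls k t).
Proof.
revert t; induction k as [|k IH]; intros t Ht; simpl; [exact Ht|].
destruct (recent t) as [|[x l] r]; [exact Ht|]; apply IH.
match goal with |- sound (if ?c then _ else _) => destruct c end; [|exact Ht].
apply sound_fold; [|exact Ht]; intros t' w H Ht'; apply sound_scan; [exact Ht'|].
apply sound_rules_at in H; [exact H|apply Ht].
Qed.

Local Arguments close : simpl never.

Lemma sound_define t x l :
  sound t -> sound (fst (define t x l)) /\ val (snd (define t x l)) = val x * env l.
Proof.
intro Ht; unfold define; destruct (get t x l) as [y|] eqn:E; simpl.
- split; [exact Ht | now apply val_get with t].
- split; [|apply val_child].
  assert (H := sound_add t (child x l) (child x l) (nodes t) 0 [] Ht eq_refl).
  refine (sound_add _ (child (child x l) (linv l)) x _ _ _ H _).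
  rewrite !val_child, env_linv; now group.
Qed.

Lemma sound_define_path t x w :
  sound t -> sound (fst (define_path t x w)) /\ val (snd (define_path t x w)) = val x * ev w.
Proof.
revert t x; induction w as [|l w IH]; intros t x Ht; simpl; [now rewrite gmulr1|].
destruct (sound_define t x l Ht) as [H E]; destruct (define t x l) as [t1 y]; simpl in H, E.
destruct (IH t1 y H) as [H' E']; split; [exact H'|]; now rewrite E', E, gmulA.
Qed.

Lemma sound_extend ls size t : sound t -> sound (extend ls size t).
Proof.
intro Ht; apply sound_fold; [|exact Ht]; intros t1 x _ H1.
apply sound_fold; [|exact H1]; intros t2 l _ H2.
destruct (Nat.leb size (live t2)); [exact H2|].
destruct (Pos.eqb (find t2 x) x); [|exact H2].
destruct (get t2 x l); [exact H2|]; now apply sound_close, sound_define.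
Qed.

Lemma ev_rotations k w v : ev w = 1 -> In v (rotations k w) -> ev v = 1.
Proof.
revert w; induction k as [|k IH]; intros [|l w] E; simpl; try easy.
intros [<-|[<-|H]].
- exact E.
- now rewrite ev_winv, E, ginv1.
- apply (IH (w ++ [l])); [|exact H]; rewrite ev_app; simpl in *; rewrite gmulr1.
  apply ginv_unique in E; rewrite E; apply gmulV.
Qed.

Lemma sound_add_rule m w : sound_rules m -> ev w = 1 -> sound_rules (add_rule m w).
Proof.
intros Hm E; destruct w as [|l w]; [exact Hm|]; intros k ws v; simpl.
rewrite find_add; destruct (Pos.eqb k (letter_code l)); [|apply Hm].
intros [= <-] [<-|H]; [exact E|]; now apply sound_rules_at with m l.
Qed.

Lemma sound_add_relator ls t r : sound t -> ev r = 1 -> sound (add_relator ls t r).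
Proof.
intros Ht Er; unfold add_relator.
assert (E : ev (free_reduce r) = 1) by now rewrite ev_free_reduce.
revert E; generalize (free_reduce r); intros w E.
set (t1 := Table _ _ _ _ _).
assert (H1 : sound t1).
{ split; [apply Ht|]; cbn [rules t1].
  generalize (ev_rotations (length w) w); generalize (rotations (length w) w).
  destruct Ht as [_ Hm]; revert Hm; generalize (rules t).
  intros m Hm ws; revert m Hm; induction ws as [|v ws IH]; intros m Hm H; simpl; [exact Hm|].
  apply IH; [apply sound_add_rule; [exact Hm | apply H; [exact E | now left]]|].
  intros v' E' H'; apply H; [exact E' | now right]. }
destruct (sound_define_path t1 1%positive w H1) as [H2 E2].
destruct (define_path t1 1%positive w) as [t2 y]; simpl in H2, E2.
apply sound_close, sound_fold.
- intros t' x _ H; destruct (Pos.eqb (find t' x) x); [now apply sound_scan | exact H].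
- apply sound_merge_all; split; [exact H2|]; intros x' y' [[= <- <-]|[]].
  now rewrite E2, E, gmulr1.
Qed.

Lemma sound_refine ls size t r : sound t -> ev r = 1 -> sound (refine ls size t r).
Proof.
intros Ht E; unfold refine; assert (H := sound_add_relator ls t r Ht E).
destruct (contradictory _); [exact H | now apply sound_extend].
Qed.

Lemma sound_start ls size rs : (forall r, In r rs -> ev r = 1) -> sound (start ls size rs).
Proof.
intro H; apply sound_extend, sound_fold; [intros t r Hr Ht; apply sound_add_relator; auto|].
apply sound_fold; [intros t w _ Ht; now apply sound_define_path|].
split; cbn [cells rules]; [|intros k ws w; now rewrite PM.gempty].
intros p q; rewrite find_add, PM.gempty; destruct (Pos.eqb_spec p 1%positive) as [->|_]; congruence.
Qed.

Lemma val_locate t w x : sound t -> locate t w = Some x -> val x = ev w.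
Proof.
intro Ht; unfold locate; generalize (val_walk t 1%positive w Ht).
destruct (walk t 1%positive w) as [y [|l r]]; [|discriminate]; simpl.
rewrite gmulr1, gmul1; intros E [= <-]; exact E.
Qed.

Lemma mem_In x L : mem x L = true -> In x L.
Proof.
intro H; apply existsb_exists in H; destruct H as [y [Hy E]].
apply Pos.eqb_eq in E; now subst y.
Qed.

(** The first alternative, for words met earlier, carries the induction and vanishes when [seen] is
    empty. *)
Lemma in_dedup t seen ws u :
  sound t -> In u ws ->
  (exists x, In x seen /\ val x = ev u) \/ (exists v, In v (dedup t seen ws) /\ ev v = ev u).
Proof.
intro Ht; revert seen; induction ws as [|w ws IH]; intros seen; [easy|]; simpl.
intros [->|H].
- destruct (locate t u) as [x|] eqn:E; [|right; exists u; split; [now left | reflexivity]].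
  destruct (mem x seen) eqn:M; [|right; exists u; split; [now left | reflexivity]].
  left; exists x; split; [now apply mem_In | now apply val_locate with t].
- destruct (locate t w) as [x|] eqn:E.
  + destruct (mem x seen) eqn:M; [now apply IH|].
    destruct (IH (x :: seen) H) as [[y [[<-|Hy] Ey]]|[v [Hv Ev]]].
    * right; exists w; split; [now left|]; rewrite <- Ey; symmetry; now apply val_locate with t.
    * left; now exists y.
    * right; exists v; split; [now right | exact Ev].
  + destruct (IH seen H) as [L|[v [Hv Ev]]]; [now left|].
    right; exists v; split; [now right | exact Ev].
Qed.

(** The list may repeat elements or leave [H], so that it can be read off a table directly. *)
Definition covers (n : nat) (H : G -> Prop) : Prop :=
  exists l : list G, length l <= n /\ forall x, H x -> In x l.

(** If right multiplication by the generators maps a list containing 1 into itself, so does every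
    element of the subgroup; applied to 1, this puts the subgroup in the list. *)
Lemma covers_of_closed t (g h : letter) n :
  sound t -> small_pair t n g h = true ->
  covers n (generated (fun y => y = env g \/ y = env h)).
Proof.
intros Ht; unfold small_pair.
set (L := orbit _ _ _ _ _); clearbody L.
intro H; apply andb_prop in H; destruct H as [H C]; apply andb_prop in H; destruct H as [N M].
exists (map val L); split; [rewrite length_map; now apply Nat.leb_le|].
intros x Hx.
set (K := fun z => forall y, In y (map val L) -> In (y * z) (map val L)).
assert (HK : forall l, In l [g; linv g; h; linv h] -> K (env l)).
{ intros l Hl z Hz; apply in_map_iff in Hz; destruct Hz as [y [<- Hy]].
  unfold closed_under in C; rewrite forallb_forall in C; specialize (C y Hy).
  rewrite forallb_forall in C; specialize (C l Hl).
  destruct (get t y l) as [u|] eqn:E; [|discriminate].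
  rewrite <- (val_get t y l u Ht E); now apply in_map, mem_In. }
assert (KM : forall y z, K y -> K z -> K (y * z)).
{ intros y z Hy Hz u Hu; rewrite gmulA; auto. }
assert (K1 : K 1) by (intros y; now rewrite gmulr1).
(* [K] is only closed under products; asking it of the inverse as well gives a subgroup. *)
assert (Kx : K x /\ K (ginv G x)).
{ apply (Hx (fun z => K z /\ K (ginv G z))).
  - split; [|split].
    + now rewrite ginv1.
    + intros y z [A B] [A' B']; rewrite ginvM; auto.
    + intros y [A B]; rewrite ginvK; auto.
  - intros y [->| ->]; rewrite <- env_linv; split; apply HK; simpl; auto. }
rewrite <- (gmul1 G x); apply Kx.
apply mem_In in M; now apply (in_map val) in M.
Qed.

End Tables.

(** * From local maximality to certificates *)

Section LocallyMaximal.

Variables (G : Group) (S : G -> Prop).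

Local Notation "x * y" := (gmul G x y).
Local Notation "1" := (gone G).
Local Notation "x ^-1" := (ginv G x) (at level 3, left associativity, format "x ^-1").

Definition in_T (x : G) : Prop :=
  S x \/ exists s t, S s /\ S t /\ (x = s * t \/ x = s * t^-1 \/ x = s^-1 * t).

(** Otherwise S with x adjoined is still product-free: a violation would put x in T(S) or x^2 in S,
    or force an element of S or x to be 1. Maximality enters the proof only here. *)
Lemma locally_maximal_cover x :
  locally_maximal_product_free S -> in_T x \/ S (x * x).
Proof.
intros [[[s0 S0] Sfree] Smax].
destruct (classic (in_T x)) as [|NT]; [now left|].
destruct (classic (S (x * x))) as [|NS]; [now right|].
exfalso; apply NT; left.
assert (no_mul : forall s t, S s -> S t -> x <> s * t)
  by (intros s t Ss St ->; apply NT; right; exists s, t; auto).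
assert (no_mulV : forall s t, S s -> S t -> x <> s * t^-1)
  by (intros s t Ss St ->; apply NT; right; exists s, t; auto).
assert (no_Vmul : forall s t, S s -> S t -> x <> s^-1 * t)
  by (intros s t Ss St ->; apply NT; right; exists s, t; auto).
assert (S1 : forall s, S s -> s <> 1)
  by (intros s Ss ->; apply (Sfree 1 1); [..|rewrite gmul1]; exact Ss).
assert (x1 : x <> 1) by (intros E; apply (no_mulV s0 s0 S0 S0); now rewrite gmulrV).
apply (Smax (fun y => S y \/ y = x)); [split|now intros y Sy; left|now right].
- now exists s0; left.
- intros a b [Sa| ->] [Sb| ->] [H|H].
  + now apply (Sfree a b).
  + now apply (no_mul a b Sa Sb).
  + apply (no_Vmul a (a * x) Sa H); now group.
  + apply (S1 a Sa), (gmulI G x^-1); rewrite gmulr1.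
    now rewrite <- H at 1; group.
  + apply (no_mulV (x * b) b H Sb); now group.
  + apply (S1 b Sb), (gmulI G x); now rewrite gmulr1.
  + now apply NS.
  + apply x1, (gmulI G x); now rewrite gmulr1.
Qed.

Definition triple (a b c : G) : Prop :=
  a <> b /\ a <> c /\ b <> c /\ forall x, S x <-> x = a \/ x = b \/ x = c.

Hypothesis S_free : forall s t, S s -> S t -> ~ S (s * t).
Hypothesis S_cover : forall x, in_T x \/ S (x * x).
Hypothesis S_pair : forall s t, S s -> S t -> s <> t ->
  forall x, generated (fun y => y = s \/ y = t) x <-> generated S x.

Local Notation H := (generated S).

Lemma H1 : H 1.
Proof. intros K [K1 _] _; exact K1. Qed.

Lemma HM x y : H x -> H y -> H (x * y).
Proof. intros Hx Hy K HK SK; apply HK; [now apply Hx | now apply Hy]. Qed.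

Lemma HV x : H x -> H x^-1.
Proof. intros Hx K HK SK; apply HK; now apply Hx. Qed.

Lemma HS x : S x -> H x.
Proof. intros Sx K _ SK; now apply SK. Qed.

Lemma HMr x y : H y -> H (x * y) -> H x.
Proof. intros Hy Hxy; replace x with (x * y * y^-1) by now group. now apply HM, HV. Qed.

Lemma square_outside x : ~ H x -> S (x * x).
Proof.
intro Hx; destruct (S_cover x) as [[Sx|[s [t [Ss [St E]]]]]|]; [..|assumption];
  exfalso; apply Hx; [now apply HS|].
destruct E as [->|[->| ->]]; apply HM; auto using HS, HV.
Qed.

(** The letters d, e, f serve for elements outside H; a certificate without them takes 1 instead. *)
Definition env6 (a b c d e f : G) (l : letter) : G :=
  match l with
  | La => a | La' => a^-1 | Lb => b | Lb' => b^-1 | Lc => c | Lc' => c^-1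
  | Ld => d | Ld' => d^-1 | Le => e | Le' => e^-1 | Lf => f | Lf' => f^-1
  end.

Lemma env6_linv a b c d e f l : env6 a b c d e f (linv l) = (env6 a b c d e f l)^-1.
Proof. destruct l; simpl; now rewrite ?ginvK. Qed.

Section Certificates.

Variables a b c d e f : G.
Hypothesis abc : triple a b c.

Local Notation env := (env6 a b c d e f).
Local Notation ev := (ev G env).
Local Notation sound := (sound G env).

Lemma S_env l : In l S_letters -> S (env l).
Proof. intros [<-|[<-|[<-|[]]]]; apply abc; simpl; auto. Qed.

Lemma S_env_inv x : S x -> exists l, In l S_letters /\ env l = x.
Proof.
intro Sx; apply abc in Sx.
destruct Sx as [->|[->| ->]]; [exists La | exists Lb | exists Lc]; simpl; auto.
Qed.

Lemma ev_distinct p : In p distinct_words -> ev (fst p) <> ev (snd p).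
Proof.
destruct abc as [ab [ac [bc _]]]; intro Hp; apply in_app_or in Hp; destruct Hp as [Hp|Hp].
- destruct Hp as [<-|[<-|[<-|[]]]]; simpl; now rewrite !gmulr1.
- apply in_flat_map in Hp; destruct Hp as [s [Hs Hp]].
  apply in_flat_map in Hp; destruct Hp as [r [Hr Hp]].
  apply in_map_iff in Hp; destruct Hp as [u [<- Hu]]; cbn [fst snd].
  simpl; rewrite !gmulr1; intro E; apply (S_free (env s) (env r)); try now apply S_env.
  rewrite E; now apply S_env.
Qed.

Lemma in_T_ev x : in_T x -> exists u, In u T_words /\ ev u = x.
Proof.
intros [Sx|[y [z [Sy [Sz E]]]]].
- destruct (S_env_inv x Sx) as [l [Hl <-]]; exists [l]; split; [|apply gmulr1].
  destruct Hl as [<-|[<-|[<-|[]]]]; simpl; tauto.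
- destruct (S_env_inv y Sy) as [l [Hl <-]], (S_env_inv z Sz) as [m [Hm <-]].
  destruct E as [->|[->| ->]]; rewrite <- ?env6_linv;
    [exists [l; m] | exists [l; linv m] | exists [linv l; m]];
    (split; [|simpl; now rewrite gmulr1]);
    destruct Hl as [<-|[<-|[<-|[]]]], Hm as [<-|[<-|[<-|[]]]]; simpl; tauto.
Qed.

(** A sound table is never contradictory, and any two elements of S generate H by [S_pair]. *)
Lemma finished_covers n t : sound t -> finished n t = true -> covers G n H.
Proof.
intros Ht Hf; unfold finished in Hf.
assert (pair : forall g h, env g <> env h -> In g S_letters -> In h S_letters ->
  small_pair t n g h = true -> covers G n H).
{ intros g h N Hg Hh C; apply (covers_of_closed G env (env6_linv a b c d e f)) in C; [|exact Ht].
  destruct C as [L [HL C]]; exists L; split; [exact HL|].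
  intros x Hx; apply C, S_pair; auto using S_env. }
assert (pair' := pair La Lb); assert (pair'' := pair La Lc); specialize (pair Lb Lc).
destruct abc as [ab [ac [bc _]]]; simpl in pair, pair', pair''.
apply Bool.orb_true_iff in Hf; destruct Hf as [Hf|Hf]; [|now apply pair; auto].
apply Bool.orb_true_iff in Hf; destruct Hf as [Hf|Hf]; [|now apply pair''; auto].
apply Bool.orb_true_iff in Hf; destruct Hf as [Hf|Hf]; [|now apply pair'; auto].
apply existsb_exists in Hf; destruct Hf as [p [Hp E]].
destruct (locate t (fst p)) as [x|] eqn:E1; [|discriminate].
destruct (locate t (snd p)) as [y|] eqn:E2; [|discriminate].
apply Pos.eqb_eq in E; subst y; exfalso; apply (ev_distinct p Hp).
transitivity (val G env x); [symmetry|]; now apply val_locate with t.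
Qed.

Lemma H_ev_S w : forallb is_S_letter w = true -> H (ev w).
Proof.
induction w as [|l w IH]; simpl; [intros; apply H1|].
intro E; apply andb_prop in E; destruct E as [El Ew]; apply HM; [|now apply IH].
destruct l; try discriminate; simpl; try apply HV; apply HS, abc; auto.
Qed.

Lemma extends_by_S_outside p w : extends_by_S p w = true -> ~ H (ev p) -> ~ H (ev w).
Proof.
intros E Hp Hw; apply Hp; clear Hp.
assert (D : exists h, H h /\ ev w = ev p * h); [|destruct D as [h [Hh D]]; rewrite D in Hw; now apply HMr in Hw].
clear Hw; revert w E; induction p as [|l p IH]; intros w E.
- exists (ev w); split; [now apply H_ev_S|]; simpl; now rewrite gmul1.
- destruct w as [|m w]; [discriminate|]; simpl in E; apply andb_prop in E; destruct E as [El E].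
  apply letter_eqb_eq in El; subst m; destruct (IH w E) as [h [Hh D]].
  exists h; split; [exact Hh|]; simpl; now rewrite D, gmulA.
Qed.

(** This is [S_cover] at the value of [w]; where [outer] places it outside H, [square_outside]
    leaves only the square. *)
Lemma options_exhaustive outer t w :
  Forall (fun p => ~ H (ev p)) outer -> sound t ->
  exists r, In r (options outer t w) /\ ev r = 1.
Proof.
intros Ho Ht.
assert (sq : S (ev w * ev w) -> exists r, In r (options outer t w) /\ ev r = 1).
{ intro Sw; destruct (S_env_inv _ Sw) as [l [Hl E]]; exists (w ++ w ++ [linv l]); split.
  - apply in_or_app; left; now apply (in_map (fun s => w ++ w ++ [linv s])).
  - rewrite !ev_app; simpl; rewrite gmulr1, env6_linv, E; now group. }
destruct (S_cover (ev w)) as [T|]; [|now apply sq].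
destruct (existsb (fun p => extends_by_S p w) outer) eqn:E.
- apply sq, square_outside; apply existsb_exists in E; destruct E as [p [Hp E]].
  rewrite Forall_forall in Ho; now apply extends_by_S_outside with p; [|apply Ho].
- destruct (in_T_ev _ T) as [u [Hu Eu]].
  destruct (in_dedup G env t [] T_words u Ht Hu) as [[x [[] _]]|[v [Hv Ev]]].
  exists (w ++ winv v); split.
  + unfold options; rewrite E; apply in_or_app; right; now apply in_map with (f := fun u => w ++ winv u).
  + rewrite ev_app, ev_winv by apply env6_linv; rewrite Ev, Eu; apply gmulrV.
Qed.

Lemma check_covers ls size n outer tr t :
  Forall (fun p => ~ H (ev p)) outer -> sound t ->
  check ls size n outer tr t = true -> covers G n H.
Proof.
(* The generated induction principle gives no hypothesis for subtrees inside a list, hence the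
   explicit [fix]. *)
intros Ho; revert tr t; fix IH 1; intros [w trs] t Ht; simpl.
destruct (options_exhaustive outer t w Ho Ht) as [r [Hr Er]].
set (t' := refine ls size t r).
assert (Ht' : sound t') by (apply sound_refine; [apply env6_linv | exact Ht | exact Er]).
destruct (finished n t') eqn:F; [intros _; now apply finished_covers with t'|].
assert (I : In t' (branches ls size n outer t w)).
{ apply filter_In; split; [now apply in_map | now rewrite F]. }
revert I; generalize (branches ls size n outer t w).
induction trs as [|tr trs IHtrs]; intros [|t1 ts] I; try easy.
intro E; apply andb_prop in E; destruct E as [E1 E2].
destruct I as [->|I]; [now apply (IH tr t') | now apply (IHtrs ts)].
Qed.

Lemma certified_covers ls size n outer rs tr :
  certified ls size n outer rs tr = true ->
  Forall (fun p => ~ H (ev p)) outer -> Forall (fun r => ev r = 1) rs ->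
  covers G n H.
Proof.
intros C Ho Hr; rewrite Forall_forall in Hr.
assert (Ht := sound_start G env (env6_linv a b c d e f) ls size rs Hr).
apply Bool.orb_true_iff in C; destruct C as [C|C].
- now apply finished_covers in C.
- now apply check_covers in C.
Qed.

End Certificates.

End LocallyMaximal.

(** * Computed certificates for the subgroup H generated by S *)

Definition letters_abc := [La; La'; Lb; Lb'; Lc; Lc'].
Definition letters_abcd := letters_abc ++ [Ld; Ld'].
Definition letters_abcde := letters_abcd ++ [Le; Le'].
Definition letters_abcdef := letters_abcde ++ [Lf; Lf'].

(* The trees were found by a search that always branches on the word, among the
   first undecided ones, with the fewest remaining options. *)
Definition tree_inverse_pair : tree :=
  Br [Lc'] [Br [La; La; La] []; Br [La; La; La] []; Br [La; La; La] []].

Lemma certified_inverse_pair :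
  certified letters_abc 30 24 [] [[La; Lb]] tree_inverse_pair = true.
Proof. now vm_compute. Qed.

Definition tree_inverse_square : tree :=
  Br [Lb; Lb; La'] [Br [La; Lc; Lb'] []; Br [Lc'] []; Br [Lc'] []; Br [Lc'] []; Br [Lc'] []; Br
  [Lc'] []; Br [Lc'] []; Br [Lc'] []; Br [Lc'] []].

Lemma certified_inverse_square :
  certified letters_abc 30 24 [] [[La; La; Lb]] tree_inverse_square = true.
Proof. now vm_compute. Qed.

Definition tree_product_one : tree :=
  Br [La; Lc; La'] [Br [La; La; Lc] [Br [La; La; Lb'] []]; Br [La; La; Lb'] [Br [La; La; La] []];
  Br [La; La; La] [Br [La; La; Lb'] []]; Br [Lb; Lb; La'] [Br [La; La; Lb'] []; Br [La; La; La]
  []; Br [La; La; Lb'] []; Br [La; La; Lc'] []; Br [La; La; La] []; Br [La; La; Lc'] []; Br [La;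
  La; La] []; Br [La; La; Lb'] []; Br [La; La; La] []; Br [Lb; Lb; Lc'] []; Br [La; La; La] [Br
  [La; La; Lb'] []]]; Br [La; La; La] [Br [La; La; Lb'] []; Br [La; Lc; Lb] []]; Br [La; Lc; Lb]
  []; Br [La; La; Lc] [Br [La; Lc; Lc] []]; Br [La; La; La] [Br [La; La; Lb'] []; Br [La; La; Lb']
  []]; Br [La; La; Lb'] [Br [La; La; La] []]; Br [La; La; Lb'] [Br [La; La; La] [Br [La; La; Lc]
  []]]; Br [La; La; La] [Br [La; La; Lb'] [Br [La; La; Lc] []]]; Br [La; La; La] [Br [La; La; Lb']
  []; Br [La; La; Lc'] []]; Br [La; Lc; Lb'] [Br [La; Lc; Lc] []]; Br [La; Lc; Lb] [Br [La; Lc;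
  Lc] []]; Br [La; La; Lb'] []; Br [La; La; La] [Br [La; La; Lc] []]; Br [La; Lc; Lb] []].

Lemma certified_product_one :
  certified letters_abc 30 24 [] [[La; Lb; Lc]] tree_product_one = true.
Proof. now vm_compute. Qed.

Definition tree_two_involutions : tree :=
  Br [Lc'] [Br [La; Lb; La] []; Br [La; Lb; La] [Br [La; Lb; Lc] []]; Br [La; Lb; La] []].

Lemma certified_two_involutions :
  certified letters_abc 30 24 [] [[La; La]; [Lb; Lb]] tree_two_involutions = true.
Proof. now vm_compute. Qed.

Definition tree_one_involution : tree :=
  Br [Lb; La; Lb'] [].

Lemma certified_one_involution :
  certified letters_abc 30 24 [] [[La; La]; [Lb; Lb; Lb]; [Lc; Lc; Lc]] tree_one_involution =
  true.
Proof. now vm_compute. Qed.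

Definition tree_exponent_three : tree :=
  Br [La; Lb; La'] [Br [La; Lb; La] []; Br [La; Lb; Lc'] [Br [La; Lb; Lc] []; Br [La; Lb; Lc] [];
  Br [La; Lb; Lc] []; Br [La; Lb; Lc] []]; Br [La; Lb; Lc] [Br [La; Lb; Lc'] []]; Br [La; Lb; La]
  [Br [La; Lb; Lc] []; Br [La; Lb; Lc] []]; Br [La; Lb; Lc'] [Br [La; Lc; La] []]; Br [La; Lb; La]
  [Br [La; Lb; Lc] []]; Br [La; Lb; La] []; Br [La; Lb; La] []; Br [La; Lb; La] [Br [La; Lb; Lc]
  []]; Br [La; Lb; La] []; Br [La; Lb; Lc] [Br [La; Lc; La] [Br [La; Lc; La'] []]; Br [La; Lb;
  Lc'] []]; Br [La; Lb; La] [Br [La; Lb; Lc] [Br [La; Lb; Lc'] []]; Br [La; Lb; Lc] []]; Br [La;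
  Lb; Lc] []; Br [La; Lb; La] [Br [La; Lb; Lc] []]].

Lemma certified_exponent_three :
  certified letters_abc 30 24 [] [[La; La; La]; [Lb; Lb; Lb]; [Lc; Lc; Lc]] tree_exponent_three =
  true.
Proof. now vm_compute. Qed.

Definition tree_cyclic_six : tree :=
  Br [] [].

(** With b = s, a = s^3 and c = s^-1, the relators alone present the cyclic group of order 6. *)
Lemma certified_cyclic_six :
  certified letters_abc 30 6 [] [[La; La]; [Lb; Lc]; [Lb; Lb; Lb; La']] tree_cyclic_six = true.
Proof. now vm_compute. Qed.

(** * Certificates with elements outside H *)

Definition tree_order_four : tree :=
  Br [Ld; Lc] [Br [Ld; La; Lc] [Br [Ld; Lc; Lc] [Br [Ld; La'; Lc] [Br [La; La; Lc] []]]]; Br [Ld;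
  La; Lc] [Br [Lc'] [Br [La; La; Lc] []]]].

(** Here a = d^2 = s with s^4 = 1, and b = (ds)^2 = s^3. The bound 3 stands for a contradiction, as
    H contains 1 and S. *)
Lemma certified_order_four :
  certified letters_abcd 40 3 [[Ld]] [[Ld; Ld; La']; [Ld; La; Ld; La; Lb']; [La; La; La; La]]
  tree_order_four = true.
Proof. now vm_compute. Qed.

Definition tree_two_squares : tree :=
  Br [Ld; Lb] [Br [Ld; Lc] [Br [Ld; La; Lc] [Br [Ld; Lb; Lc] [Br [Ld; Lc; Lc] [Br [La; Lb; Lc]
  []]]]; Br [Ld; La; Lc] [Br [Lc'] [Br [La; Lb; Lc] []]]]; Br [Ld; La; Lb] [Br [Ld; Lc; Lc] [Br
  [Ld; Lb; Lc'] [Br [La; Lb; Lc] []]]]].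

(** An involution a = d^2 with d outside H excludes a second involution b in S. *)
Lemma certified_two_squares :
  certified letters_abcd 40 3 [[Ld]] [[Ld; Ld; La']; [La; La]; [Lb; Lb]] tree_two_squares = true.
Proof. now vm_compute. Qed.

Definition tree_index_two : tree :=
  Br [Ld; La; Lb] [Br [Ld; La; Lc] [Br [Ld; Lb; Lb] [Br [Ld; Lb; Lc] [Br [Ld; Lc; Lc] [Br [Ld; Lb;
  Lc'] [Br [Ld; Lb'; Lc] [Br [Ld; La; Lb; Lb] [Br [Ld; La; Lb; Lc] [Br [Ld; La; Lb; Lc'] [Br [Ld;
  La; Lc; Lb'] [Br [Ld; La; Lc; Lc] [Br [Lb'] [Br [La; Lb; Lc'] [Br [La; Lc; Lb'] []]; Br [La; Lb;
  Lb] []; Br [La; Lb; Lc'] [Br [La; Lc; Lb'] []]; Br [La; Lb; Lb] [Br [La; Lb; Lc']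
  []]]]]]]]]]]]]]].

(** The involution a is the square of d, db and dc. *)
Lemma certified_index_two :
  certified letters_abcd 40 12 [[Ld]] [[Ld; Ld; La']; [La; La]; [Ld; Lb; Ld; Lb; La']; [Ld; Lc;
  Ld; Lc; La']] tree_index_two = true.
Proof. now vm_compute. Qed.

Definition tree_index_four : tree :=
  Br [Ld; Le; La] [Br [Ld; Le; La; Lb] [Br [Ld; Lc] [Br [Ld; La; Lc] [Br [Ld; Lb; Lc] [Br [Le; Lc]
  [Br [Le; La; Lc] [Br [Le; Lb; Lc] [Br [Ld; Lc; Lc] [Br [Le; Lc; Lc] [Br [Ld; Lb; Lc'] [Br [Le;
  Lb; Lc'] [Br [Ld; Le; Lc] [Br [La; Lb; Lc] []; Br [Lc'] []]]]]]]]; Br [Le; La; Lc] [Br [Le; Lb;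
  Lc] [Br [Ld; Lc; Lc] [Br [Le; Lc; Lc] [Br [Ld; Le; Lc] [Br [Lc'] []; Br [La; Lb; Lc] []]]]]]]]];
  Br [Ld; La; Lc] [Br [Ld; Lb; Lc] [Br [Ld; Lc; Lc] [Br [Le; Lc] [Br [Le; La; Lc] [Br [Le; Lb; Lc]
  [Br [Le; Lc; Lc] [Br [Ld; Le; Lc] [Br [Lc'] []; Br [La; Lb; Lc] []]]]]; Br [Le; La; Lc] [Br [Le;
  Lb; Lc] [Br [Le; Lc; Lc] [Br [Ld; Le; Lc] [Br [La; Lb; Lc] []; Br [Lc'] []]]]]]]]]]]].

(** Refutes an index above 2: d, e, de and their products with b on the right all have square a. *)
Lemma certified_index_four :
  certified letters_abcde 40 3 [[Ld]; [Le]; [Ld; Le]] [[La; La]; [Ld; Ld; La']; [Le; Le; La'];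
  [Ld; Le; Ld; Le; La']; [Ld; Lb; Ld; Lb; La']; [Le; Lb; Le; Lb; La']; [Ld; Le; Lb; Ld; Le; Lb;
  La']] tree_index_four = true.
Proof. now vm_compute. Qed.

Definition tree_index_eight : tree :=
  Br [Ld; Le] [Br [Ld; Lb] [Br [Le; Lb] [Br [Lf; Lb] [Br [Ld; Lf] [Br [Ld; Le; Lf] [Br [Le; Lf]
  []]; Br [Ld; Le; Lf] [Br [Le; Lf] []]; Br [Ld; Le; Lf] [Br [Le; Lf] []]]; Br [Ld; Lf] [Br [Le;
  Lf] [Br [Ld; Le; Lf] []]]]; Br [Le; Lf] [Br [Ld; Le; Lb] [Br [Lf; Lb] [Br [Le; Lf; Lb] [Br [Ld;
  Le; La; Lb] [Br [Ld; Lf] [Br [Ld; Le; Lf] []; Br [Ld; Le; Lf] []; Br [Ld; Le; Lf] []]]]; Br [Ld;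
  Lf] [Br [Ld; Le; Lf] []]]]]]; Br [Ld; Lf] [Br [Le; Lb] [Br [Ld; Le; Lb] [Br [Lf; Lb] [Br [Ld;
  Lf; Lb] [Br [Ld; Le; La; Lb] [Br [Ld; Lf; La; Lb] [Br [Le; Lf] [Br [Ld; Le; Lf] []; Br [Ld; Le;
  Lf] []; Br [Ld; Le; Lf] []]]]]; Br [Le; Lf] [Br [Ld; Le; Lf] []]]]; Br [Le; Lf] [Br [Ld; Le; Lf]
  []]]]]; Br [Lf; Lb] [Br [Ld; Le; Lf] [Br [Ld; Le; Lf; La] [Br [Ld; Le; Lf; Lb] [Br [Ld; Lf] [Br
  [Le; Lf] []; Br [Le; Lf] []; Br [Le; Lf] []]]]]; Br [Ld; Lf] [Br [Le; Lf] [Br [Ld; Le; Lf]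
  []]]]; Br [Lf; Lb] [Br [Ld; Le; Lf] [Br [Ld; Le; Lf; La] [Br [Ld; Le; Lf; Lb] [Br [Ld; Lf] [Br
  [Le; Lf] []; Br [Le; Lf] []; Br [Le; Lf] []]]]]; Br [Ld; Lf] [Br [Le; Lf] [Br [Ld; Le; Lf]
  []]]]].

(** Refutes an index above 4 for S = {s^3, s, s^5}, where d, e, f have square s^3. *)
Lemma certified_index_eight :
  certified letters_abcdef 40 3 [[Ld]; [Le]; [Lf]; [Ld; Le]; [Ld; Lf]; [Le; Lf]; [Ld; Le; Lf]]
  [[La; La]; [Ld; Ld; La']; [Le; Le; La']; [Lf; Lf; La']; [Lb; Lc]; [Lb; Lb; Lb; La']]
  tree_index_eight = true.
Proof. now vm_compute. Qed.

(** * The bound on the order of G *)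

Section Bound.

Variables (G : Group) (S : G -> Prop).

Local Notation "x * y" := (gmul G x y).
Local Notation "1" := (gone G).
Local Notation "x ^-1" := (ginv G x) (at level 3, left associativity, format "x ^-1").

Hypothesis S_free : forall s t, S s -> S t -> ~ S (s * t).
Hypothesis S_cover : forall x, in_T G S x \/ S (x * x).
Hypothesis S_pair : forall s t, S s -> S t -> s <> t ->
  forall x, generated (fun y => y = s \/ y = t) x <-> generated S x.

Local Notation H := (generated S).
Local Notation triple := (triple G S).

(** The certificates fix the roles of a, b, c; this lemma and the next two rename the elements of S
    to match. *)
Lemma triple_of_distinct a b c x y z :
  triple a b c -> S x -> S y -> S z -> x <> y -> x <> z -> y <> z -> triple x y z.
Proof.
intros [ab [ac [bc E]]] Sx Sy Sz xy xz yz; split; [exact xy|]; split; [exact xz|]; split; [exact yz|].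
intro s; split; [|intros [->|[->| ->]]; assumption].
apply E in Sx, Sy, Sz; intro Ss; apply E in Ss.
destruct Sx as [->|[->| ->]], Sy as [->|[->| ->]], Sz as [->|[->| ->]]; try congruence; tauto.
Qed.

Lemma triple_of_pair a b c x y :
  triple a b c -> S x -> S y -> x <> y -> exists z, triple x y z.
Proof.
intros T Sx Sy xy.
assert (D : exists z, S z /\ x <> z /\ y <> z).
{ destruct T as [ab [ac [bc E]]]; assert (Sx' := Sx); assert (Sy' := Sy).
  apply E in Sx, Sy.
  destruct (classic (a = x)) as [<-|ax]; [destruct (classic (b = y)) as [<-|bx]|
    destruct (classic (a = y)) as [<-|ay]; [destruct (classic (b = x)) as [<-|by']|]].
  - exists c; rewrite E; tauto.
  - exists b; rewrite E; intuition congruence.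
  - exists c; rewrite E; tauto.
  - exists b; rewrite E; intuition congruence.
  - exists a; rewrite E; intuition congruence. }
destruct D as [z [Sz [xz yz]]]; exists z; now apply (triple_of_distinct a b c).
Qed.

Lemma triple_of_element a b c x : triple a b c -> S x -> exists y z, triple x y z.
Proof.
intros T Sx.
assert (D : exists y, S y /\ x <> y).
{ destruct T as [ab [ac [bc E]]]; apply E in Sx.
  destruct (classic (x = a)) as [->|xa]; [exists b | exists a]; rewrite E; auto. }
destruct D as [y [Sy xy]]; exists y; now apply (triple_of_pair a b c).
Qed.

Lemma S_neq1 s : S s -> s <> 1.
Proof. intros Ss ->; apply (S_free 1 1 Ss Ss); now rewrite gmul1. Qed.

(** As 1, a, b, c are distinct elements of H, a certificate with bound 3 is a refutation. *)
Lemma not_covers_three a b c : triple a b c -> ~ covers G 3 H.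
Proof.
intros [ab [ac [bc E]]] [l [Hl C]].
assert (Sa : S a) by (apply E; auto); assert (Sb : S b) by (apply E; auto);
assert (Sc : S c) by (apply E; auto).
assert (N : NoDup [1; a; b; c]).
{ assert (a <> 1 /\ b <> 1 /\ c <> 1) as [a1 [b1 c1]] by auto using S_neq1.
  repeat constructor; simpl; intuition congruence. }
assert (4 <= length l); [|lia].
apply (NoDup_incl_length N); intros x Hx; apply C.
destruct Hx as [<-|[<-|[<-|[<-|[]]]]]; [apply H1|apply HS..]; assumption.
Qed.

(* If s^-1 is in T(S), it can only be a product of at most two elements of S,
   and otherwise s^-2 is in S. *)
Lemma inverse_cases s : S s ->
  (exists t, S t /\ s * t = 1) \/ (exists t u, S t /\ S u /\ s * t * u = 1).
Proof.
intro Ss; destruct (S_cover s^-1) as [[Si|[t [u [St [Su E]]]]]|Si].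
- left; exists s^-1; split; [exact Si | apply gmulrV].
- destruct E as [E|[E|E]].
  + right; exists t, u; split; [exact St|]; split; [exact Su|]; rewrite <- gmulA, <- E; apply gmulrV.
  + exfalso; apply (S_free s t Ss St); replace (s * t) with u; [exact Su|].
    rewrite <- (ginvK G s), E; now group.
  + exfalso; apply (S_free u s Su Ss); replace (u * s) with t; [exact St|].
    rewrite <- (ginvK G s), E; now group.
- right; exists s, (s^-1 * s^-1); split; [exact Ss|]; split; [exact Si|]; now group.
Qed.

Lemma mul_eq1C x y : x * y = 1 -> y * x = 1.
Proof. intro E; apply ginv_unique in E; rewrite E; apply gmulV. Qed.

Ltac relators := repeat constructor; simpl; group; auto.

(** The relators st, s^2t and stu between distinct elements are treated first. Without them
    [inverse_cases] leaves s^2 = 1 or s^3 = 1 for each s, and the number of involutions decides. *)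
Lemma covers_generated a b c : triple a b c -> covers G 24 H.
Proof.
intro T.
assert (C := fun a b c T => certified_covers G S S_free S_cover S_pair a b c 1 1 1 T).
destruct (classic (exists s t, S s /\ S t /\ s <> t /\ s * t = 1)) as [[s [t [Ss [St [N E]]]]]|N1].
{ destruct (triple_of_pair a b c s t T Ss St N) as [u T'].
  apply (C s t u T' _ _ _ _ _ _ certified_inverse_pair); relators. }
destruct (classic (exists s t, S s /\ S t /\ s <> t /\ s * s * t = 1)) as [[s [t [Ss [St [N E]]]]]|N2].
{ rewrite <- gmulA in E; destruct (triple_of_pair a b c s t T Ss St N) as [u T'].
  apply (C s t u T' _ _ _ _ _ _ certified_inverse_square); relators. }
destruct (classic (exists s t u, triple s t u /\ s * t * u = 1)) as [[s [t [u [T' E]]]]|N3].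
{ rewrite <- gmulA in E; apply (C s t u T' _ _ _ _ _ _ certified_product_one); relators. }
assert (O : forall s, S s -> s * s = 1 \/ s * (s * s) = 1).
{ intros s Ss; destruct (inverse_cases s Ss) as [[t [St E]]|[t [u [St [Su E]]]]].
  - left; destruct (classic (s = t)) as [<-|N]; [exact E|]; exfalso; apply N1; eauto 6.
  - right; destruct (classic (s = t)) as [<-|N]; [destruct (classic (s = u)) as [<-|N]|].
    + now rewrite gmulA.
    + exfalso; apply N2; eauto 6.
    (* If two letters of stu coincide, a cyclic rotation gives the excluded relator s^2t. *)
    + destruct (classic (s = u)) as [<-|N']; [|destruct (classic (t = u)) as [<-|N'']]; exfalso.
      * apply N2; exists s, t; repeat split; auto.
        apply mul_eq1C in E; now rewrite gmulA in E.
      * apply N2; exists t, s; repeat split; auto.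
        rewrite <- gmulA in E; now apply mul_eq1C in E.
      * apply N3; exists s, t, u; split; [|exact E]; now apply (triple_of_distinct a b c). }
assert (two : forall s t, S s -> S t -> s <> t -> s * s = 1 -> t * t = 1 -> covers G 24 H).
{ intros s t Ss St N Es Et; destruct (triple_of_pair a b c s t T Ss St N) as [u T'].
  apply (C s t u T' _ _ _ _ _ _ certified_two_involutions); relators. }
assert (one : forall s t u, triple s t u -> s * s = 1 -> covers G 24 H).
{ intros s t u T' Es; assert (T'' := T'); destruct T'' as [st [su [tu D]]].
  destruct (O t) as [Et|Et]; [apply D; auto|apply (two s t); auto; apply D; auto|].
  destruct (O u) as [Eu|Eu]; [apply D; auto|apply (two s u); auto; apply D; auto|].
  apply (C s t u T' _ _ _ _ _ _ certified_one_involution); relators. }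
assert (some : forall s, S s -> s * s = 1 -> covers G 24 H).
{ intros s Ss; destruct (triple_of_element a b c s T Ss) as [t [u T']]; now apply (one s t u). }
assert (Sa : S a) by (apply T; auto); assert (Sb : S b) by (apply T; auto);
assert (Sc : S c) by (apply T; auto).
destruct (O a Sa) as [Ea|Ea]; [now apply (some a)|].
destruct (O b Sb) as [Eb|Eb]; [now apply (some b)|].
destruct (O c Sc) as [Ec|Ec]; [now apply (some c)|].
apply (C a b c T _ _ _ _ _ _ certified_exponent_three); relators.
Qed.

(** [gs] lists inverses of left coset representatives, so that a failure of the covering says that
    words such as de lie outside H, as [outer] expects. *)
Lemma covers_cosets n gs :
  covers G n H -> (forall y, exists g, In g gs /\ H (g * y)) ->
  covers G (length gs * n) (fun _ => True).
Proof.
intros [l [Hl C]] D.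
exists (flat_map (fun g => map (fun h => g^-1 * h) l) gs); split.
- clear D; induction gs as [|g gs IH]; simpl; [lia|]; rewrite length_app, length_map; lia.
- intros y _; destruct (D y) as [g [Hg Hy]]; apply in_flat_map; exists g; split; [exact Hg|].
  apply in_map_iff; exists (g * y); split; [now group | now apply C].
Qed.

Lemma not_H_mul x h : H h -> ~ H x -> ~ H (x * h).
Proof. intros Hh Hx Hxh; apply Hx; now apply (HMr G S x h). Qed.

Ltac outside := repeat (constructor; [simpl; rewrite ?gmulr1; assumption|]); constructor.

(* Here S = {s, s^3, s^5} for an element s of order 6. *)
Lemma bound_nonelementary a b c x :
  triple a b c -> ~ H x -> x * x * (x * x) <> 1 -> covers G 24 (fun _ => True).
Proof.
intros T0 Hx N; set (s := x * x) in *.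
assert (Ss : S s) by now apply square_outside.
assert (Hs := HS G S s Ss).
assert (odd : forall k, H k -> S (x * k * (x * k)))
  by (intros k Hk; apply square_outside, not_H_mul; assumption).
(* As s = x^2, the square of x s^k is s^(2k+1); here k = 1, 2, 3. *)
assert (S3 : S (s * (s * s))).
{ replace (s * (s * s)) with (x * s * (x * s)) by (unfold s; now group). now apply odd. }
assert (S5 : S (s * (s * (s * (s * s))))).
{ replace (s * (s * (s * (s * s)))) with (x * (s * s) * (x * (s * s))) by (unfold s; now group).
  now apply odd, HM. }
assert (S7 : S (s * (s * (s * (s * (s * (s * s))))))).
{ replace (s * (s * (s * (s * (s * (s * s)))))) with (x * (s * (s * s)) * (x * (s * (s * s))))
    by (unfold s; now group).
  apply odd, HM; [|apply HM]; exact Hs. }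
assert (s13 : s <> s * (s * s)).
{ intro E; apply N, (gmulI G s); rewrite gmulr1; now symmetry. }
assert (N4 : s * (s * (s * s)) <> 1).
{ intro E4; destruct (triple_of_pair a b c s _ T0 Ss S3 s13) as [u T].
  apply (not_covers_three _ _ _ T).
  apply (certified_covers G S S_free S_cover S_pair _ _ _ x 1 1 T _ _ _ _ _ _ certified_order_four).
  - outside.
  - unfold s; constructor; [|constructor; [|constructor; [|constructor]]]; simpl; group; auto.
    unfold s in E4; revert E4; now group. }
assert (T : triple (s * (s * s)) s (s * (s * (s * (s * s))))).
{ apply (triple_of_distinct a b c); auto; intro E.
  - do 2 apply (gmulI G s) in E; now apply s13.
  - apply N4, (gmulI G s); rewrite gmulr1; now symmetry. }
(* Of the values of s^7 in S, s^3 would give s^4 = 1 and s^5 would give s^2 = 1, so that s^7 = s. *)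
assert (E6 : s * (s * (s * (s * (s * s)))) = 1).
{ apply T in S7; destruct S7 as [E|[E|E]]; apply (gmulI G s); rewrite gmulr1.
  - exfalso; apply N4, (gmulI G s), (gmulI G s), (gmulI G s); now rewrite gmulr1, E.
  - exact E.
  - exfalso; apply N; do 5 apply (gmulI G s); now rewrite gmulr1, E. }
revert T; set (v := s * (s * (s * (s * s)))); set (z := s * (s * s)); intro T.
assert (R : z * z = 1 /\ s * v = 1 /\ s * (s * (s * z^-1)) = 1).
{ split; [|split]; [|exact E6|].
  - unfold z; revert E6; now group.
  - apply mul_eq1C; unfold z; now group. }
destruct R as [Rz [Rv Rs]]; assert (Ez : z = s * (s * s)) by reflexivity; clearbody z v.
(* Every coset y <S> contains the element y^3, whose square is z. *)
assert (norm : forall y, ~ H y -> exists k, S k /\ y * k * (y * k) = z).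
{ intros y Hy; exists (y * y); assert (Sy := square_outside G S S_cover y Hy); split; [exact Sy|].
  replace (y * (y * y) * (y * (y * y))) with (y * y * (y * y * (y * y))) by now group.
  revert Sy; generalize (y * y); intros u Su; apply T in Su; destruct Su as [->|[->| ->]].
  - now rewrite Rz, gmulr1.
  - now symmetry.
  - apply ginv_unique in Rv; rewrite Rv, <- !ginvM, <- gmulA, <- Ez.
    symmetry; now apply ginv_unique. }
assert (C := fun d e f => certified_covers G S S_free S_cover S_pair _ _ _ d e f T).
assert (C6 : covers G 6 H).
{ apply (C 1 1 1 _ _ _ _ _ _ certified_cyclic_six); [constructor|].
  constructor; [|constructor; [|constructor; [|constructor]]]; simpl; rewrite !gmulr1; assumption. }
destruct (norm x Hx) as [k [Sk Ed]]; assert (Hd := not_H_mul x k (HS G S k Sk) Hx).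
revert Hd Ed; generalize (x * k); intros d Hd Ed.
(* Without such an element the index is at most 2; otherwise it is normalized to have square z, as
   was done for d. *)
destruct (classic (exists e, ~ H e /\ ~ H (d * e))) as [[e0 [He0 Hde0]]|I2].
2: { destruct (covers_cosets 6 [1; d]) as [l' [Hl' C']].
  - exact C6.
  - intro y; destruct (classic (H y)) as [Hy|Hy].
    + exists 1; rewrite gmul1; simpl; auto.
    + exists d; split; [simpl; auto|]; apply NNPP; intro Hdy; apply I2; eauto.
  - exists l'; split; [simpl in *; lia | exact C']. }
destruct (norm e0 He0) as [m [Sm Ee]]; assert (Hm := HS G S m Sm).
assert (He := not_H_mul e0 m Hm He0); assert (Hde := not_H_mul (d * e0) m Hm Hde0).
rewrite <- gmulA in Hde; revert He Hde Ee; generalize (e0 * m); clear dependent e0.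
intros e He Hde Ee.
change 24 with (Nat.mul (length [1; d; e; d * e]) 6); apply covers_cosets; [exact C6|].
(* A further coset would yield, after normalization, the f that [certified_index_eight] excludes. *)
intro y; apply NNPP; intro Ny.
assert (Hy : forall g, In g [1; d; e; d * e] -> ~ H (g * y))
  by (intros g Hg Hgy; apply Ny; eauto).
assert (Y1 := Hy 1); assert (Yd := Hy d); assert (Ye := Hy e); assert (Yde := Hy (d * e)).
rewrite gmul1 in Y1; simpl in Y1, Yd, Ye, Yde.
destruct (norm y) as [p [Sp Ef]]; [tauto|]; assert (Hp := HS G S p Sp).
apply (not_covers_three _ _ _ T).
apply (C d e (y * p) _ _ _ _ _ _ certified_index_eight).
- assert (F1 : ~ H (y * p)) by (apply not_H_mul; tauto).
  assert (F2 : ~ H (d * (y * p))) by (rewrite gmulA; apply not_H_mul; tauto).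
  assert (F3 : ~ H (e * (y * p))) by (rewrite gmulA; apply not_H_mul; tauto).
  assert (F4 : ~ H (d * (e * (y * p)))) by (rewrite !gmulA; apply not_H_mul; tauto).
  outside.
- revert Ef; generalize (y * p); intros f Ef.
  repeat (constructor; [simpl; rewrite ?gmulr1; try assumption; rewrite gmulA, ?Ed, ?Ee, ?Ef; apply gmulrV|]).
  constructor.
Qed.

Lemma bound_elementary a b c d :
  triple a b c -> (forall x, ~ H x -> x * x * (x * x) = 1) -> ~ H d -> covers G 24 (fun _ => True).
Proof.
intros T0 I Hd; assert (Ss := square_outside G S S_cover d Hd).
destruct (triple_of_element a b c _ T0 Ss) as [b' [c' T]].
assert (Ea := I d Hd); assert (Ed : d * d = d * d) by reflexivity.
(* The fifth occurrence is kept, so that [Ed] becomes [d * d = s]. *)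
revert T Ss Ea Ed; generalize (d * d) at 1 2 3 4 6; intros s T Ss Ea Ed.
(* A different square would be a second involution of S. *)
assert (U : forall x, ~ H x -> x * x = s).
{ intros x Hx; apply NNPP; intro N; assert (Sx := square_outside G S S_cover x Hx).
  destruct (triple_of_pair a b c s (x * x) T0 Ss Sx) as [u T']; [congruence|].
  apply (not_covers_three _ _ _ T').
  apply (certified_covers G S S_free S_cover S_pair _ _ _ d 1 1 T' _ _ _ _ _ _ certified_two_squares).
  - outside.
  - repeat (constructor; [simpl; rewrite ?gmulr1|]); try constructor; auto.
    rewrite gmulA, Ed; apply gmulrV. }
assert (V : forall x, ~ H x -> x * (x * s^-1) = 1)
  by (intros x Hx; rewrite gmulA, (U x Hx); apply gmulrV).
assert (W : forall x k, ~ H x -> H k -> x * (k * (x * (k * s^-1))) = 1).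
{ intros x k Hx Hk; assert (E := V (x * k) (not_H_mul x k Hk Hx)); now rewrite <- !gmulA in E. }
assert (Hb : H b') by (apply HS, T; auto); assert (Hc : H c') by (apply HS, T; auto).
assert (C := fun d e => certified_covers G S S_free S_cover S_pair _ _ _ d e 1 T).
change 24 with (Nat.mul (length [1; d]) 12); apply covers_cosets.
- apply (C d 1 _ _ _ _ _ _ certified_index_two); [outside|].
  repeat (constructor; [simpl; rewrite ?gmulr1; auto|]); constructor.
(* An e in a third coset makes d, e and de lie outside H, where [U] fixes all squares. *)
- intro e; apply NNPP; intro Ne.
  assert (He : ~ H e) by (intro He; apply Ne; exists 1; rewrite gmul1; simpl; auto).
  assert (Hde : ~ H (d * e)) by (intro Hde; apply Ne; exists d; simpl; auto).
  apply (not_covers_three _ _ _ T), (C d e _ _ _ _ _ _ certified_index_four); [outside|].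
  assert (V' := V _ Hde); assert (W' := W _ b' Hde Hb); rewrite <- !gmulA in V', W'.
  repeat (constructor; [simpl; rewrite ?gmulr1; auto|]); constructor.
Qed.

Lemma covers_group a b c : triple a b c -> covers G 24 (fun _ => True).
Proof.
intro T; destruct (classic (exists x, ~ H x)) as [[d Hd]|N].
- destruct (classic (exists x, ~ H x /\ x * x * (x * x) <> 1)) as [[x [Hx Nx]]|I].
  + now apply (bound_nonelementary a b c x).
  + apply (bound_elementary a b c d T); [|exact Hd].
    intros x Hx; apply NNPP; intro Nx; apply I; eauto.
- destruct (covers_generated a b c T) as [l [Hl C]]; exists l; split; [exact Hl|].
  intros x _; apply C, NNPP; eauto.
Qed.

End Bound.

(** Turns the lists of [covers] into the repetition-free lists of [order_le]. *)
Lemma nodup_exists (A : Type) (l : list A) :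
  exists l', NoDup l' /\ (forall x, In x l -> In x l') /\ length l' <= length l.
Proof.
induction l as [|x l [l' [N [I L]]]]; [exists []; repeat split; auto; constructor|].
destruct (classic (In x l')) as [Hx|Hx].
- exists l'; split; [exact N|]; split; [|simpl; lia]; intros y [<-|Hy]; auto.
- exists (x :: l'); split; [now constructor|]; split; [|simpl; lia].
  intros y [<-|Hy]; simpl; auto.
Qed.

Theorem theorem1p1 (G : Group) (S : G -> Prop) :
  locally_maximal_product_free S ->
  card3 S ->
  (forall a b : G, S a -> S b -> a <> b ->
     forall x, generated (fun y => y = a \/ y = b) x <-> generated S x) ->
  order_le G 24.
Proof.
intros M [a [b [c T]]] P.
destruct (covers_group G S) with (a := a) (b := b) (c := c) as [l [Hl C]].
- apply M.
- intro x; now apply locally_maximal_cover.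
- exact P.
- exact T.
- destruct (nodup_exists G l) as [l' [N [I L]]].
  exists l'; split; [exact N|]; split; [auto | lia].
Qed.
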